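(* Let $n$ be a positive integer such that every component of $4n+1$ is congruent to $1$ modulo $4$. Then there exist a subgroup $J$ of order $2$ of $D\times\{0\}$ and a $J$-resolvable $(D\times V_{4n+1},D\times\{0\},3,1)$ difference family admitting a group of strong multipliers whose order is the greatest odd divisor of $\psi(4n+1)$.
   Context: A component of an integer is a maximal prime power dividing it. For an integer $N>1$ with components $q_1,\dots,q_\omega$, $\mathbb F_N$ denotes the ring $\mathbb F_{q_1}\times\dots\times\mathbb F_{q_\omega}$, $V_N$ its additive group, and $\psi(N)=\prod_i(q_i-1)$ the order of its unit group. $D$ is the group on $\mathbb Z_2\times\mathbb Z_3$ with $(a,b)+(c,d)=(a+c,(-1)^cb+d)$. Groups are written additively, $x-y:=x+(-y)$. For a subgroup $H$ of $G$, a $(G,H,3,1)$ difference family is a family $\mathcal F$ of $3$-subsets of $G$ such that the multiset of differences $x-y$ over ordered pairs of distinct elements in a common block equals $G\setminus H$ (each element once); for $J\le H$ of order $2$, $\mathcal F$ is $J$-resolvable if the multiset union of its blocks is a complete system of representatives for the left cosets $g+J$ of $J$ not contained in $H$. A strong multiplier of $\mathcal F$ is an automorphism of $G$ fixing $H$ elementwise and mapping the set of blocks of $\mathcal F$ onto itself. *)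

(* Defs.v *)
From HB Require Import structures.
From mathcomp Require Import all_boot all_order all_fingroup all_algebra.
From mathcomp Require Import all_solvable all_field.

Set Implicit Arguments.
Unset Strict Implicit.
Unset Printing Implicit Defensive.

Import GroupScope GRing.Theory.

Definition components (N : nat) : seq nat := [seq (p ^ logn p N)%N | p <- primes N].

Definition psi (N : nat) : nat := (\prod_(q <- components N) (q - 1))%N.

Definition greatest_odd_divisor (m : nat) : nat :=
  (\max_(d <- divisors m | odd d) d)%N.

(* The components of N are indexed by its prime divisors. *)
Section ComponentField.

Variables (N : nat) (p : seq_sub (primes N)).

Lemma component_prime : prime (val p).
Proof. by have := valP p; rewrite mem_primes; case/andP. Qed.

Lemma component_exponent_gt0 : (0 < logn (val p) N)%N.
Proof. by rewrite logn_gt0; exact: valP. Qed.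

Definition component_field : finFieldType :=
  s2val (pPrimePowerField component_prime component_exponent_gt0).

Lemma card_component_field : #|component_field| = (val p ^ logn (val p) N)%N.
Proof. by rewrite /component_field; case: pPrimePowerField. Qed.

End ComponentField.

(* The additive group of the product ring of the component fields: the group
   law on finite dependent functions is componentwise, and the group law of a
   finite field F, seen as a finGroupType, is the addition of F. *)
Definition V (N : nat) : finGroupType :=
  {dffun forall p : seq_sub (primes N), (component_field p : finGroupType)}.

(* A type of its own, as 'Z_2 * 'Z_3 is already equipped with the direct
   product law. *)
Definition D : Type := ('Z_2 * 'Z_3)%type.

HB.instance Definition _ := Finite.copy D ('Z_2 * 'Z_3)%type.

Definition D_add (x y : D) : D :=
  (x.1 + y.1, (-1) ^+ (y.1 : nat) * x.2 + y.2)%R.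

Definition D_zero : D := (0, 0)%R.

Definition D_opp (x : D) : D := (- x.1, - ((-1) ^+ (x.1 : nat) * x.2))%R.

Lemma Z2_cases (a : 'Z_2) : a = 0%R \/ a = 1%R.
Proof. by case: a => [[|[|[]]] //] i; [left | right]; apply: val_inj. Qed.

Lemma D_addA : associative D_add.
Proof.
move=> [a b] [c d] [e f]; rewrite /D_add /= !addrA; congr pair.
rewrite mulrDr mulrA; congr (_ * b + _ + _)%R.
by case: (Z2_cases c) => ->; case: (Z2_cases e) => ->; apply: val_inj.
Qed.

Lemma D_add0 : left_id D_zero D_add.
Proof. by move=> [a b]; rewrite /D_add /= mulr0 !add0r. Qed.

Lemma D_addN : left_inverse D_zero D_opp D_add.
Proof.
move=> [a b]; rewrite /D_add /D_opp /D_zero /=; congr pair; first exact: addNr.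
by case: (Z2_cases a) => ->; rewrite /= ?expr0 ?expr1 ?mul1r ?mulN1r ?opprK addNr.
Qed.

HB.instance Definition _ := Finite_isGroup.Build D D_addA D_add0 D_addN.

(* Groups are finGroupTypes, hence multiplicative: the difference x - y is
   x * y^-1 and the left coset g + J is g *: J. The ambient group is the whole
   type, and a family of blocks is a sequence, read up to order. *)
Section DifferenceFamilies.

Variable gT : finGroupType.
Implicit Types (H J : {group gT}) (F : seq {set gT}).

Definition differences F : seq gT :=
  flatten [seq [seq xy.1 * xy.2^-1 | xy <- enum (setX B B) & xy.1 != xy.2]
          | B : {set gT} <- F].

(* (gT, H, 3, 1) difference family *)
Definition difference_family H F : Prop :=
  {in F, forall B : {set gT}, #|B| = 3%N} /\
  perm_eq (differences F) (enum (~: H)).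

Definition block_union F : seq gT := flatten [seq enum B | B : {set gT} <- F].

Definition resolvable H J F : Prop :=
  perm_eq [seq g *: J | g <- block_union F]
          (enum [set C in lcosets J [set: gT] | ~~ (C \subset H)]).

Definition strong_multiplier H F (a : {perm gT}) : Prop :=
  [/\ a \in Aut [set: gT],
      {in H, forall h, a h = h} &
      [set a @: (B : {set gT}) | B in F] = [set B in F]].

End DifferenceFamilies.

Definition DV (N : nat) : finGroupType := (D * V N)%type.

Definition Dx0 (N : nat) : {group DV N} := setX_group [set: D]%G (one_group (V N)).

(* Main.v *)
Require Import Defs.
From mathcomp Require Import all_boot all_order all_fingroup all_algebra.
From mathcomp Require Import all_solvable all_field.

Set Implicit Arguments.
Unset Strict Implicit.
Unset Printing Implicit Defensive.

Import GRing.Theory.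

(** Write W for the additive group of F_N and let i be an element of F_N with
i^2 = -1, so that multiplication by the powers of i is a semiregular action of
a cyclic group of order 4 on W \ {0}. It commutes with the multiplication by
units of odd order; these form a group U of order prime to 4, and therefore <i>
has a U-invariant transversal M on W \ {0}. Take four base blocks whose
elements have the form (d, i^r), with d in D, such that for each d the
differences with first component d have as second components the multiples by
the powers of i of a fixed element 1 - i^k with k <> 0, which is invertible,
and such that each left coset of J in D meets the first components paired with
i^r exactly once for each r. The multiples of the base blocks by the elements of
M form the family, and U permutes them. As the counts agree, it is enough to
show that every element outside H is a difference, and that every coset
outside H is met. *)

Lemma perm_eq_min_size (T : eqType) (s1 s2 : seq T) :
  uniq s1 -> {subset s1 <= s2} -> size s2 <= size s1 -> perm_eq s2 s1.
Proof.
move=> Us1 s12 le21; apply: uniq_perm => //; first exact: leq_size_uniq le21.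
by have [_ eq12] := uniq_min_size Us1 s12 le21 => x; rewrite eq12.
Qed.

Lemma size_flatten_map (S : eqType) (T : Type) (f : S -> seq T) n (s : seq S) :
  {in s, forall x, size (f x) = n} -> size (flatten (map f s)) = n * size s.
Proof.
move=> size_f; rewrite size_flatten /shape -map_comp sumnE big_map.
by rewrite (eq_big_seq _ size_f) big_const_seq count_predT iter_addn_0.
Qed.

Lemma card_offdiag (T : finType) (B : {set T}) :
  #|[set xy in setX B B | xy.1 != xy.2]| = #|B| * #|B|.-1.
Proof.
rewrite -sum1_card (eq_bigl (fun xy => (xy.1 \in B) && (xy.2 \in B :\ xy.1))).
  rewrite -(pair_big_dep (mem B) (fun x y => y \in B :\ x) (fun _ _ => 1)) /=.
  rewrite -sum_nat_const; apply: eq_bigr => x Bx.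
  by rewrite sum1_card (cardsD1 x B) Bx.
by case=> x y; rewrite !inE /= -andbA eq_sym; congr (_ && _); apply: andbC.
Qed.

Section DifferenceFamilyCriteria.

Local Open Scope group_scope.

Variable gT : finGroupType.
Implicit Types (F : seq {set gT}) (H J : {group gT}).

Lemma mem_differences F (B : {set gT}) x y :
  B \in F -> x \in B -> y \in B -> x != y -> x * y^-1 \in differences F.
Proof.
move=> FB Bx By x'y; apply/flatten_mapP; exists B => //.
by apply/mapP; exists (x, y); rewrite // mem_filter x'y mem_enum inE /= Bx.
Qed.

Lemma size_differences k F :
    {in F, forall B : {set gT}, #|B| = k} ->
  size (differences F) = (k * k.-1 * size F)%N.
Proof.
move=> cardF; apply: size_flatten_map => B FB.
rewrite size_map -(cardF B FB) -card_offdiag cardE; apply/perm_size/uniq_perm.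
- exact/filter_uniq/enum_uniq.
- exact: enum_uniq.
by move=> xy; rewrite mem_filter !mem_enum [RHS]inE andbC.
Qed.

Lemma size_block_union k F :
    {in F, forall B : {set gT}, #|B| = k} ->
  size (block_union F) = (k * size F)%N.
Proof.
by move=> cardF; apply: size_flatten_map => B FB; rewrite -cardE cardF.
Qed.

Lemma card_lcosets_out H J :
    J \subset H ->
  (#|[set C in lcosets J [set: gT] | ~~ (C \subset H)]| * #|J|)%N = #|~: H|.
Proof.
move=> sJH; set P := [set C in _ | _].
have lcosets_in : lcosets J [set: gT] :&: powerset H = lcosets J H.
  apply/setP=> C; rewrite !inE.
  apply/andP/lcosetsP=> [[/lcosetsP[g _ ->] sgJH] | [g Hg ->]].
    by exists g; rewrite // (subsetP sgJH) ?lcoset_refl.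
  by rewrite -(lcoset_id Hg) mulgS //; split=> //; apply/lcosetsP; exists g.
have lcosets_out : lcosets J [set: gT] :\: powerset H = P.
  by apply/setP=> C; rewrite !inE andbC.
have := cardsID (powerset H) (lcosets J [set: gT]).
rewrite lcosets_in lcosets_out !card_lcosets => card_split.
apply/eqP; rewrite -(eqn_add2l #|H|) cardsC -cardsT -(Lagrange sJH).
by rewrite -(Lagrange (subsetT J)) -card_split mulnDr mulnC (mulnC #|P|).
Qed.

Lemma difference_family_of_cover H F :
    {in F, forall B : {set gT}, #|B| = 3} -> (6 * size F <= #|~: H|)%N ->
    (forall g, g \notin H -> g \in differences F) ->
  difference_family H F.
Proof.
move=> cardF le_FH coverF; split=> //.
apply: perm_eq_min_size; first exact: enum_uniq.
  by move=> g; rewrite mem_enum inE; apply: coverF.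
by rewrite (size_differences cardF) -cardE.
Qed.

Lemma resolvable_of_cover k H J F :
    {in F, forall B : {set gT}, #|B| = k} ->
    (k * size F * #|J| <= #|~: H|)%N -> J \subset H ->
    (forall g, g \notin H ->
       exists2 B : {set gT}, B \in F & exists2 b, b \in B & b \in g *: J) ->
  resolvable H J F.
Proof.
move=> cardF le_FH sJH coverF; apply: perm_eq_min_size; first exact: enum_uniq.
  move=> C; rewrite mem_enum inE => /andP[/lcosetsP[g _ ->{C}] gJ'H].
  have Hg : g \notin H.
    by apply: contra gJ'H => Hg; rewrite -(lcoset_id Hg) mulgS.
  have [B FB [b Bb gJb]] := coverF g Hg.
  apply/mapP; exists b; last by rewrite (lcoset_eqP gJb).
  by apply/flatten_mapP; exists B; rewrite ?mem_enum.
rewrite size_map (size_block_union cardF) -cardE.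
by rewrite -(leq_pmul2r (cardG_gt0 J)) card_lcosets_out.
Qed.

End DifferenceFamilyCriteria.

Section InvariantTransversal.

Local Open Scope group_scope.

Variables (aT : finGroupType) (rT : finType) (to : {action aT &-> rT}).
Variables (S : {set rT}) (U C : {group aT}).
Hypotheses (actsU : [acts U, on S | to]) (actsC : [acts C, on S | to]).
Hypotheses (cUC : U \subset 'C(C)) (coUC : coprime #|U| #|C|).
Hypothesis semiregC : {in S, forall x, 'C_C[x | to] = 1}.

(* [(u * c) ^+ #|U| = c ^+ #|U|] is trivial by semiregularity, and then so is
[c] since its order is prime to [#|U|]. *)
Lemma coprime_semiregular_fix x u c :
  x \in S -> u \in U -> c \in C -> to x (u * c) = x -> c = 1.
Proof.
move=> Sx Uu Cc fix_x; have cuc : commute u c by apply: (centsP cUC).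
have cX1 : c ^+ #|U| = 1.
  apply/set1P; rewrite -[[set 1]](semiregC Sx) inE groupX //=.
  rewrite -[c ^+ _]mul1g -(expg_cardG Uu) -expgMn //.
  by apply/groupX/astab1P.
apply/eqP; rewrite -order_eq1 -dvdn1 -(eqP coUC) dvdn_gcd.
by rewrite order_dvdn cX1 eqxx order_dvdG.
Qed.

Lemma translates_orbit_eq (T : {set rT}) :
    T \subset S ->
    {in T &, forall t s, (s \in orbit to (U <*> C) t) = (t == s)} ->
  {in [set to t u | t in T, u in U] &, forall x y, y \in orbit to C x -> y = x}.
Proof.
move=> sTS orbT _ _ /imset2P[t u Tt Uu ->] /imset2P[s v Ts Uv ->].
case/orbitP=> c Cc tuc_sv; have Uuv : u * v^-1 \in U by rewrite groupM ?groupV.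
have tuvc_s : to t (u * v^-1 * c) = s.
  have cvc : commute v^-1 c by apply: (centsP cUC); rewrite ?groupV.
  by rewrite -mulgA cvc mulgA 2!actM tuc_sv actK.
have /eqP eq_ts : t == s.
  rewrite -orbT // -tuvc_s mem_orbit //= cent_joinEr ?mem_mulg //.
  by rewrite centsC.
suffices c1 : c = 1 by rewrite -tuc_sv c1 act1.
apply: (coprime_semiregular_fix (subsetP sTS t Tt) Uuv Cc).
by rewrite tuvc_s eq_ts.
Qed.

Lemma exists_invariant_transversal :
  exists2 M : {set rT},
    [acts U, on M | to] & is_transversal M (orbit to C @: S) S.
Proof.
have joinE : U <*> C = U * C by apply: cent_joinEr; rewrite centsC.
have [|_ sTS orbT coverT] := @orbit_transversalP _ _ _ to (U <*> C) S.
  by rewrite /= joinE mul_subG.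
set T := orbit_transversal _ _ _ in sTS orbT coverT.
exists [set to t u | t in T, u in U].
  apply/actsP=> v Uv x; apply/idP/idP=> /imset2P[t u Tt Uu].
    move/(canRL (actK to v)); rewrite -actM => ->.
    by apply/imset2P; exists t (u * v^-1); rewrite ?groupM ?groupV.
  by move=> ->; rewrite -actM; apply/imset2P; exists t (u * v); rewrite ?groupM.
apply/and3P; split; first exact: orbit_partition.
  apply/subsetP=> _ /imset2P[t u Tt Uu ->].
  by rewrite (acts_act actsU) // (subsetP sTS).
apply/forall_inP=> _ /imsetP[x Sx ->].
have [g + Txg] := coverT x Sx; rewrite /= joinE => /mulsgP[u c Uu Cc def_g].
have Mxc : to x c \in [set to t u | t in T, u in U].
  apply/imset2P; exists (to x g) u^-1; rewrite ?groupV //.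
  by rewrite -actM def_g (centsP cUC u Uu c Cc) mulgK.
apply/cards1P; exists (to x c); apply/setP=> y; rewrite !inE.
apply/andP/eqP=> [[My xy] | ->]; last by rewrite mem_orbit.
by apply: (translates_orbit_eq sTS orbT); rewrite ?orbit_act.
Qed.

End InvariantTransversal.

Section FixedPoints.

Local Open Scope group_scope.

Variable gT : finGroupType.

Lemma odd_invg_fix (x : gT) : odd #|gT| -> x^-1 = x -> x = 1.
Proof.
move=> odd_gT /eqP; rewrite eq_invg_mul => /eqP xx1.
apply/eqP; rewrite -order_eq1 -dvdn1 -(eqP (_ : coprime #|[set: gT]| 2)).
  by rewrite dvdn_gcd order_dvdG ?inE //= order_dvdn expgS xx1.
by rewrite coprimen2 cardsT.
Qed.

Lemma fixfree_mulV_surj (f : gT -> gT) :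
    {morph f : x y / x * y} -> (forall x, f x = x -> x = 1) ->
  forall w, exists z, w = z * (f z)^-1.
Proof.
move=> fM fix1; have inj_f : injective (fun z => z * (f z)^-1).
  move=> y z eq_yz; apply/esym/eqP; rewrite eq_mulVg1; apply/eqP/fix1.
  have <- : (f z)^-1 * f y = f (z^-1 * y) by rewrite -{1}(mulKVg z y) fM mulKg.
  apply: (mulgI z); apply: (mulIg (f y)^-1).
  by rewrite mulKVg mulgA mulgK.
by move=> w; exists (invF inj_f w); rewrite [RHS](f_invF inj_f).
Qed.

End FixedPoints.

Section ActSnd.

Local Open Scope group_scope.

Variables (aT : finGroupType) (T1 T2 : finType) (to : {action aT &-> T2}).

Definition act_snd (x : T1 * T2) a := (x.1, to x.2 a).

Fact act_snd1 : act_snd^~ 1 =1 id.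
Proof. by case=> x y; rewrite /act_snd act1. Qed.

Fact act_sndM x : act_morph act_snd x.
Proof. by move=> a b; rewrite /act_snd actM. Qed.

Canonical act_snd_action := TotalAction act_snd1 act_sndM.

Lemma act_snd_faithful (A : {set aT}) :
    0 < #|T1| -> [faithful A, on [set: T2] | to] ->
  [faithful A, on [set: T1 * T2] | act_snd_action].
Proof.
move=> /card_gt0P[x _] /faithfulP faithA.
apply/faithfulP=> a Aa fix_a; apply: faithA => // y _.
by have [] := fix_a (x, y) (in_setT _).
Qed.

End ActSnd.

Lemma act_snd_is_groupAction (aT E W : finGroupType)
    (to : groupAction [set: aT] [set: W]) :
  is_groupAction [set: E * W] (act_snd_action E to).
Proof.
move=> a _; rewrite inE; apply/andP; split; first by apply/subsetP=> x /[!inE].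
apply/morphicP=> [[d x] [e y]] _ _.
by rewrite !actpermE /= /act_snd /= gactM ?inE.
Qed.

Definition admits_resolvable_family
    (gT : finGroupType) (H : {group gT}) (m : nat) : Prop :=
  exists (J : {group gT}) (F : seq {set gT}),
    [/\ J \subset H, #|J| = 2, difference_family H F, resolvable H J F &
        exists A : {group {perm gT}},
          (forall a, a \in A -> strong_multiplier H F a) /\ #|A| = m].

(* The entry [(d, r)] of a block stands for [(d, i^r)], where [i^2 = -1]. *)
Local Notation pattern E := (seq (seq (E * 'Z_4))).

Section Patterns.

Local Open Scope group_scope.

Variable E : finGroupType.
Implicit Types (B : seq (E * 'Z_4)) (P : pattern E) (d j : E).
Implicit Types k r : 'Z_4.

(* The two pairs [(a, b)] listed are those for which [i^2 = -1] yields
[i^a - i^b = i^r (1 - i^k)] formally. *)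
Definition covers_difference P d k r : bool :=
  has (fun B => has (fun p => has (fun q => (p.1 * q.1^-1 == d) &&
    ((p.2, q.2) \in [:: (r, r + k); (r + k + 2, r + 2)]%R)) B) B) P.

Definition covers_coset P j d r : bool :=
  has (has (fun p => (p.1 \in [:: d; d * j]) && (p.2 == r))) P.

End Patterns.

Section QuarterTurn.

Local Open Scope group_scope.

Variables (aT W : finGroupType) (to : groupAction [set: aT] [set: W]) (i : aT).
Hypotheses (oddW : odd #|W|) (faithT : [faithful [set: aT], on [set: W] | to]).
Hypothesis turn_sqr : forall x, to x (i ^+ 2) = x^-1.

Implicit Types (x y z w : W) (a b k r : 'Z_4).

Lemma turn_mulC x y : x * y = y * x.
Proof.
by apply: invg_inj; rewrite -turn_sqr gactM ?inE // !turn_sqr invMg.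
Qed.

Lemma turnX4 : i ^+ 4 = 1.
Proof.
move/faithfulP: faithT; apply=> [|x _]; first by rewrite inE.
by rewrite (expgD _ 2 2) actM !turn_sqr invgK.
Qed.

Lemma turnX_fix n x : x != 1 -> to x (i ^+ n) = x -> 4 %| n.
Proof.
move=> x_neq1 fix_x; apply: contraNT x_neq1 => n4.
have [j nj2] : exists j, (n * j = 2 %[mod 4])%N.
  have := ltn_pmod n (isT : 0 < 4); rewrite /dvdn in n4.
  case: (n %% 4)%N n4 (modnMml n ^~ 4) => [|[|[|[|?]]]] // _ mod_n _.
  - by exists 2; rewrite -mod_n.
  - by exists 1%N; rewrite -mod_n.
  by exists 2; rewrite -mod_n.
apply/eqP/odd_invg_fix => //; rewrite -turn_sqr -(expg_mod 2 turnX4) -nj2.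
by rewrite expg_mod ?turnX4 // expgM; apply/astab1P/groupX/astab1P.
Qed.

Lemma turnXD a b : i ^+ (a + b)%R = i ^+ a * i ^+ b.
Proof. by rewrite -expgD -(expg_mod (a + b) turnX4). Qed.

Lemma turnX_inj x : x != 1 -> injective (fun a : 'Z_4 => to x (i ^+ a)).
Proof.
move=> x_neq1 a b eq_ab; apply/eqP; rewrite -subr_eq0.
suffices : 4 %| (a - b)%R by rewrite /dvdn modn_small.
apply: turnX_fix x_neq1 _; apply: (act_inj to (i ^+ b)).
by rewrite -actM -turnXD subrK.
Qed.

Lemma turn_diff_surj k :
  k != 0%R -> forall w, exists z, w = z * (to z (i ^+ k))^-1.
Proof.
move=> k_neq0; apply: fixfree_mulV_surj => [x y | x fix_x].
  by rewrite gactM ?inE.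
apply: contraNeq k_neq0 => x_neq1; apply/eqP.
by apply: (turnX_inj x_neq1); rewrite fix_x act1.
Qed.

Lemma turn_diffE k r x a b :
    (a, b) \in [:: (r, r + k); (r + k + 2, r + 2)]%R ->
  to x (i ^+ a) * (to x (i ^+ b))^-1 =
    to x (i ^+ r) * (to (to x (i ^+ r)) (i ^+ k))^-1.
Proof.
have turn_half s : to x (i ^+ (s + 2%R : 'Z_4)%R) = (to x (i ^+ s))^-1.
  by rewrite turnXD actM turn_sqr.
rewrite !inE => /orP[]/eqP[-> ->]; first by rewrite turnXD actM.
by rewrite !turn_half turnXD actM invgK turn_mulC.
Qed.

Lemma orbit_turn x : orbit to <[i]> x = [set to x (i ^+ a) | a : 'Z_4].
Proof.
apply/setP=> y; apply/orbitP/imsetP=> [[_ /cycleP[n ->] <-] | [a _ ->]].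
  by exists (inZp n); rewrite //= expg_mod ?turnX4.
by exists (i ^+ a); rewrite ?mem_cycle.
Qed.

Definition turn_transversal (M : {set W}) : bool :=
  is_transversal M (orbit to <[i]> @: [set~ 1]) [set~ 1].

Section Transversal.

Variable M : {set W}.
Hypothesis trM : turn_transversal M.

Lemma turn_transversal_neq1 m : m \in M -> m != 1.
Proof. by move/(subsetP (transversal_sub trM)); rewrite !inE. Qed.

Lemma turn_transversal_cover x :
  x != 1 -> exists2 m, m \in M & exists a : 'Z_4, x = to m (i ^+ a).
Proof.
move=> x_neq1; have /and3P[_ _ /forall_inP/(_ (orbit to <[i]> x))] := trM.
rewrite imset_f ?inE // => /(_ isT)/cards1P[m /setP/(_ m)].
rewrite !inE eqxx => /andP[Mm]; rewrite orbit_sym orbit_turn.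
by case/imsetP=> a _ ->; exists m => //; exists a.
Qed.

Lemma card_turn_transversal : #|W|.-1 = (#|M| * 4)%N.
Proof.
have /and3P[partM _ _] := trM; rewrite -(cardsC1 1) (card_transversal trM).
apply: card_uniform_partition partM => _ /imsetP[x x_neq1 ->].
rewrite orbit_turn card_imset ?card_ord //; apply: turnX_inj.
by rewrite !inE in x_neq1.
Qed.

End Transversal.

Lemma exists_turn_transversal (U : {group aT}) :
    U \subset 'C[i] -> odd #|U| ->
  exists2 M : {set W}, [acts U, on M | to] & turn_transversal M.
Proof.
move=> cUi oddU; have actsT (A : {set aT}) : [acts A, on [set~ 1] | to].
  apply/actsP=> a _ x; rewrite !inE -{1}(gact1 to (in_setT a)).
  by rewrite (inj_eq (act_inj to a)).
apply: exists_invariant_transversal => //; first by rewrite cent_cycle.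
  apply: (@coprime_dvdr _ 4); first by rewrite order_dvdn turnX4.
  by rewrite -[4]/(2 ^ 2)%N coprime_pexpr ?coprimen2.
move=> x; rewrite !inE => x_neq1.
apply/trivgP/subsetP=> _ /setIP[/cycleP[n ->]].
move/astab1P/(turnX_fix x_neq1)/dvdnP=> [m ->].
by rewrite mulnC expgM turnX4 expg1n inE.
Qed.

Section DevelopedFamily.

Variable E : finGroupType.
Implicit Types (B : seq (E * 'Z_4)) (d : E) (m : W).

Definition develop B m : {set E * W} :=
  [set (p.1, to m (i ^+ p.2)) | p : E * 'Z_4 in B].

Definition developed_family (P : pattern E) (M : {set W}) :=
  [seq develop B m | B <- P, m <- enum M].

Lemma card_develop B m : uniq B -> m != 1 -> #|develop B m| = size B.
Proof.
move=> uniqB m_neq1; rewrite card_imset; first exact/card_uniqP.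
move=> [d r] [e s] /= [-> eq_rs]; congr pair.
exact: turnX_inj eq_rs.
Qed.

Lemma im_actperm_develop B m u : u \in 'C[i] ->
  actperm (act_snd_action E to) u @: develop B m = develop B (to m u).
Proof.
move=> /cent1P cui; rewrite -imset_comp; apply: eq_imset => p /=.
rewrite actpermE /= /act_snd /= -!actM; congr (_, to m _).
exact/esym/commuteX.
Qed.

Let H : {group E * W} := setX_group [set: E]%G (one_group W).

Lemma notin_base d w : ((d, w) \notin H) = (w != 1).
Proof. by rewrite !inE. Qed.

Lemma card_base_compl : #|~: H| = (#|E| * #|W|.-1)%N.
Proof.
rewrite -(cardsC1 (1 : W)) -cardsT -cardsX; congr #|pred_of_set _|.
by apply/setP=> [[d x]]; rewrite !inE.
Qed.

Variables (j : E) (P : pattern E) (M : {set W}).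
Hypothesis size_blocks : {in P, forall B, uniq B /\ size B = 3}.
Hypothesis size_pattern : (3 * size P <= 2 * #|E|)%N.
Hypothesis trM : turn_transversal M.

Let F := developed_family P M.

Lemma mem_developed B m : B \in P -> m \in M -> develop B m \in F.
Proof. by move=> PB Mm; apply: allpairs_f; rewrite ?mem_enum. Qed.

Lemma developedP (B' : {set E * W}) :
  B' \in F -> exists B m, [/\ B \in P, m \in M & B' = develop B m].
Proof. by case/allpairsP=> [[B m] /=]; rewrite mem_enum => ?; exists B, m. Qed.

Lemma card_developed_block : {in F, forall B : {set E * W}, #|B| = 3}.
Proof.
move=> _ /developedP[B [m [/size_blocks[uniqB <-] Mm ->]]].
by rewrite card_develop ?(turn_transversal_neq1 trM).
Qed.

Lemma size_developed_family : (6 * size F <= #|~: H|)%N.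
Proof.
rewrite size_allpairs -cardE card_base_compl (card_turn_transversal trM).
rewrite (mulnC #|M|) !mulnA leq_mul2r (mulnC #|E|); apply/orP; right.
by rewrite -[6]/(2 * 3)%N -[4]/(2 * 2)%N -!mulnA leq_pmul2l.
Qed.

Lemma developed_difference_family :
    (forall d, exists2 k, k != 0%R & forall r, covers_difference P d k r) ->
  difference_family H F.
Proof.
move=> cover_diff; apply: difference_family_of_cover card_developed_block _ _.
  exact: size_developed_family.
move=> [d w]; rewrite notin_base => w_neq1.
have [k k_neq0 diff_dk] := cover_diff d.
have [z def_w] := turn_diff_surj k_neq0 w.
have z_neq1 : z != 1.
  by apply: contraNneq w_neq1 => z1; rewrite def_w z1 gact1 ?inE // mulgV.
have [m Mm [r def_z]] := turn_transversal_cover trM z_neq1.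
have /hasP[B PB /hasP[p Bp /hasP[q Bq /andP[/eqP def_d def_r]]]] := diff_dk r.
have -> : (d, w) = (p.1, to m (i ^+ p.2)) * (q.1, to m (i ^+ q.2))^-1.
  by rewrite def_w def_z -(turn_diffE m def_r) -def_d.
apply: (mem_differences (mem_developed PB Mm)).
- by apply/imsetP; exists p.
- by apply/imsetP; exists q.
apply: contraNneq w_neq1 => -[_ eq_pq].
by rewrite def_w def_z -(turn_diffE m def_r) eq_pq mulgV.
Qed.

Lemma developed_resolvable :
    #[j] = 2 -> (forall d r, covers_coset P j d r) ->
  resolvable H (setX_group <[j]> (one_group W)) F.
Proof.
move=> order_j cover_coset; have JE : <[j]> = [set 1; j] by apply: cycle2g.
apply: resolvable_of_cover card_developed_block _ _ _.
- by rewrite cardsX cards1 -orderE order_j muln1 mulnAC size_developed_family.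
- by rewrite setXS ?subsetT.
move=> [d w]; rewrite notin_base => w_neq1.
have [m Mm [r def_w]] := turn_transversal_cover trM w_neq1.
have /hasP[B PB /hasP[p Bp /andP[d_p /eqP r_p]]] := cover_coset d r.
exists (develop B m); first exact: mem_developed.
exists (p.1, to m (i ^+ p.2)); first by apply/imsetP; exists p.
rewrite mem_lcoset r_p -def_w; apply/setXP; split=> /=; last first.
  by rewrite mulVg inE.
rewrite JE; move: d_p; rewrite !inE => /orP[]/eqP->.
  by rewrite mulVg eqxx.
by rewrite mulKg eqxx orbT.
Qed.

Lemma developed_strong_multiplier u :
    u \in 'C[i] -> u \in 'N(M | to) ->
  strong_multiplier H F (actperm (act_snd_action E to) u).
Proof.
move=> cui nMu; split.
- by apply: act_snd_is_groupAction; rewrite inE.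
- move=> [d x]; rewrite -[_ \in _]negbK notin_base negbK => /eqP->.
  by rewrite actpermE /= /act_snd gact1 ?inE.
apply/eqP; rewrite eqEcard card_imset; last exact/imset_inj/perm_inj.
rewrite cardsE leqnn andbT; apply/subsetP=> _ /imsetP[B' FB' ->].
have [B [m [PB Mm ->]]] := developedP FB'.
by rewrite inE im_actperm_develop // mem_developed // (astabs_act _ nMu).
Qed.

End DevelopedFamily.

Theorem quarter_turn_family (E : finGroupType) (j : E)
    (P : pattern E) (U : {group aT}) :
    {in P, forall B, uniq B /\ size B = 3} -> 3 * size P <= 2 * #|E| ->
    (forall d, exists2 k, k != 0%R & forall r, covers_difference P d k r) ->
    #[j] = 2 -> (forall d r, covers_coset P j d r) ->
    U \subset 'C[i] -> odd #|U| ->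
  admits_resolvable_family (setX_group [set: E]%G (one_group W)) #|U|.
Proof.
move=> size_blocks size_pattern cover_diff order_j cover_coset cUi oddU.
have [M actsM trM] := exists_turn_transversal cUi oddU.
exists (setX_group <[j]> (one_group W)), (developed_family P M); split.
- by rewrite setXS ?subsetT.
- by rewrite cardsX cards1 -orderE order_j.
- exact: developed_difference_family.
- exact: developed_resolvable.
exists (actperm (act_snd_action E to) @* U)%G.
split=> [_ /morphimP[u _ Uu ->] | ].
  apply: developed_strong_multiplier => //; first exact: (subsetP cUi).
  exact: (subsetP actsM).
have E_gt0 : 0 < #|E| by rewrite -cardsT cardG_gt0.
have := act_snd_faithful E_gt0 faithT; rewrite /faithful setTI => faith_snd.
by rewrite card_injm ?subsetT // ker_actperm.
Qed.

End QuarterTurn.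

Section DihedralPattern.

Local Open Scope ring_scope.

(* Found by a computer search. *)
Definition dihedral_pattern : pattern D :=
  [:: [:: ((0, 0), 0); ((0, 1), 1); ((0, 0), 2)];
      [:: ((0, 1), 0); ((0, 0), 1); ((1, 2), 3)];
      [:: ((0, 2), 0); ((1, 1), 2); ((0, 0), 3)];
      [:: ((0, 2), 1); ((1, 2), 2); ((0, 2), 3)]].

(* Unlike [enum], this enumeration and the next one reduce to explicit lists. *)
Definition Zp_enum n : seq 'I_n.+1 := [seq inZp k | k <- iota 0 n.+1].

Lemma mem_Zp_enum n (x : 'I_n.+1) : x \in Zp_enum n.
Proof. by rewrite -[x]valZpK map_f // mem_iota ltn_ord. Qed.

Definition dihedral_enum : seq D :=
  [seq (a, b) | a <- Zp_enum 1, b <- Zp_enum 2].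

Lemma mem_dihedral_enum d : d \in dihedral_enum.
Proof. by case: d => a b; apply: allpairs_f; apply: mem_Zp_enum. Qed.

Lemma dihedral_allP (Q : D -> 'Z_4 -> bool) :
  all (fun d => all (Q d) (Zp_enum 3)) dihedral_enum -> forall d r, Q d r.
Proof.
move=> /allP allQ d r.
exact: (allP (allQ d (mem_dihedral_enum d))) (mem_Zp_enum r).
Qed.

Definition dihedral_reflection : D := (1, 0).

Lemma order_dihedral_reflection : #[dihedral_reflection]%g = 2%N.
Proof.
by apply: nt_prime_order => //; rewrite expgS expg1; apply/eqP; vm_compute.
Qed.

Lemma size_dihedral_pattern_block :
  {in dihedral_pattern, forall B, uniq B /\ size B = 3%N}.
Proof.
move=> B PB; suff/allP/(_ B PB)/andP[-> /eqP->] :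
  all (fun B => uniq B && (size B == 3%N)) dihedral_pattern by [].
by vm_compute.
Qed.

Lemma dihedral_pattern_differences (d : D) : exists2 k, k != 0 &
  forall r, covers_difference dihedral_pattern d k r.
Proof.
pose shift (e : D) : 'Z_4 := if e \in [:: (0, 0); (1, 2)] then 2 else 1.
exists (shift d); first by rewrite /shift; case: ifP.
by move: d; apply: dihedral_allP; vm_compute.
Qed.

Lemma dihedral_pattern_cosets (d : D) (r : 'Z_4) :
  covers_coset dihedral_pattern dihedral_reflection d r.
Proof. by move: d r; apply: dihedral_allP; vm_compute. Qed.

End DihedralPattern.

Section DffunAction.

Local Open Scope group_scope.

Variables (I : finType) (aT rT : I -> finGroupType).
Variable to : forall p, groupAction [set: aT p] [set: rT p].

Local Notation aTn := {dffun forall p, aT p}.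
Local Notation rTn := {dffun forall p, rT p}.

Definition dffun_act (x : rTn) (a : aTn) : rTn := [ffun p => to p (x p) (a p)].

Fact dffun_act1 : dffun_act^~ 1 =1 id.
Proof. by move=> x; apply/ffunP=> p; rewrite !ffunE act1. Qed.

Fact dffun_actM x : act_morph dffun_act x.
Proof. by move=> a b; apply/ffunP=> p; rewrite !ffunE actM. Qed.

Canonical dffun_action := TotalAction dffun_act1 dffun_actM.

Fact dffun_is_groupAction : is_groupAction [set: rTn] dffun_action.
Proof.
move=> a _; rewrite inE; apply/andP; split; first by apply/subsetP=> x /[!inE].
apply/morphicP=> x y _ _; apply/ffunP=> p.
by rewrite !actpermE !ffunE gactM ?inE.
Qed.

Canonical dffun_groupAction := GroupAction dffun_is_groupAction.

Lemma dffun_act_faithful :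
    (forall p, [faithful [set: aT p], on [set: rT p] | to p]) ->
  [faithful [set: aTn], on [set: rTn] | dffun_action].
Proof.
move=> faith_to; apply/faithfulP=> a _ fix_a; apply/ffunP=> p; rewrite ffunE.
move/faithfulP: (faith_to p); apply=> [|x _]; first by rewrite inE.
by have /ffunP/(_ p) := fix_a (dfung1 x) (in_setT _); rewrite ffunE dfung1_id.
Qed.

End DffunAction.

Lemma unit_act_faithful (R : finUnitRingType) :
  [faithful [set: {unit R}], on [set: R] | 'U]%g.
Proof.
apply/faithfulP=> u _ fix_u; apply: val_inj.
by have := fix_u 1%R (in_setT _); rewrite /= FinRing.unit_actE mul1r.
Qed.

Lemma card_dffun (I : finType) (T : I -> finType) :
  #|{: {dffun forall p, T p}}| = \prod_p #|{: T p}|.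
Proof. by rewrite card_dep_ffun foldrE big_image. Qed.

Lemma greatest_odd_divisorE m : 0 < m -> greatest_odd_divisor m = m`_2^'.
Proof.
move=> m_gt0; apply/eqP; rewrite /greatest_odd_divisor eqn_leq.
apply/andP; split.
  apply/bigmax_leqP_seq => d; rewrite -dvdn_divisors // => d_m odd_d.
  rewrite dvdn_leq ?part_gt0 // -(@part_pnat_id 2^' d) ?partn_dvd //.
  by rewrite -odd_2'nat.
apply: leq_bigmax_seq; first by rewrite -dvdn_divisors ?dvdn_part.
by rewrite odd_2'nat part_pnat.
Qed.

Lemma finField_sqrtN1 (K : finFieldType) :
  #|K| = 1 %[mod 4] -> exists a : {unit K}, (val a ^+ 2 = -1)%R.
Proof.
move=> K1; have /cyclicP[g defG] := field_unit_group_cyclic [set: {unit K}]%G.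
have dv4 : 4 %| #[g]%g.
  rewrite orderE -defG card_finField_unit -subn1 -eqn_mod_dvd ?K1 //.
  exact/ltnW/finNzRing_gt1.
pose a := (g ^+ (#[g] %/ 4))%g; exists a.
have order_a : #[a]%g = 4 by rewrite orderXdiv ?dvdn_div // divnA // mulKn.
have a2_neq1 : (a ^+ 2 != 1)%g by rewrite -order_dvdn order_a.
have /eqP : ((val a ^+ 2) ^+ 2 = 1)%R.
  by rewrite -exprM -FinRing.val_unitX -[(2 * 2)%N]order_a expg_order.
rewrite sqrf_eq1 -FinRing.val_unitX -FinRing.val_unit1.
by rewrite (inj_eq val_inj) (negPf a2_neq1) => /eqP.
Qed.

Section ProductOfFields.

Variables (I : finType) (K : I -> finFieldType).

Local Notation unit_prod := {dffun forall p, {unit (K p)}}.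

Definition field_prod : finGroupType := {dffun forall p, (K p : finGroupType)}.

Lemma unit_prod_abelian : abelian [set: unit_prod].
Proof.
by apply/centsP=> u _ v _; apply/ffunP=> p; rewrite !ffunE; apply/val_inj/mulrC.
Qed.

Lemma card_unit_prod : #|{: unit_prod}| = \prod_p (#|K p| - 1).
Proof.
rewrite card_dffun; apply: eq_bigr => p _.
by rewrite -cardsT card_finField_unit subn1.
Qed.

Definition scale : groupAction [set: unit_prod] [set: field_prod] :=
  dffun_groupAction (fun p => 'U%gact).

Lemma scale_faithful :
  [faithful [set: unit_prod], on [set: field_prod] | scale]%g.
Proof. by apply: dffun_act_faithful => p; apply: unit_act_faithful. Qed.

Hypothesis K_mod4 : forall p, #|K p| = 1 %[mod 4].

Lemma odd_card_field_prod : odd #|field_prod|.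
Proof.
rewrite card_dffun; apply: (big_ind odd) => // [m n odd_m odd_n | p _].
  by rewrite oddM odd_m.
by rewrite -(@odd_mod _ 4) // K_mod4.
Qed.

Lemma exists_quarter_turn :
  exists i : unit_prod, forall x : field_prod, (scale x (i ^+ 2) = x^-1)%g.
Proof.
have [a a2] := fin_all_exists (fun p => finField_sqrtN1 (K_mod4 p)).
exists (finfun a) => x; apply/ffunP=> p; rewrite !ffunE /=.
by rewrite FinRing.unit_actE FinRing.val_unitM -expr2 a2 mulrN1.
Qed.

Theorem field_prod_resolvable_family :
  admits_resolvable_family (setX_group [set: D]%G (one_group field_prod))
    (greatest_odd_divisor (\prod_p (#|K p| - 1))).
Proof.
have [i turn_sqr] := exists_quarter_turn.
pose U := 'O_2^'([set: unit_prod])%G.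
have -> : greatest_odd_divisor (\prod_p (#|K p| - 1)) = #|U|.
  rewrite -card_unit_prod -cardsT greatest_odd_divisorE ?cardG_gt0 //.
  exact/esym/card_Hall/nilpotent_pcore_Hall/abelian_nil/unit_prod_abelian.
apply: (quarter_turn_family odd_card_field_prod scale_faithful turn_sqr).
- exact: size_dihedral_pattern_block.
- by rewrite card_prod !card_ord.
- exact: dihedral_pattern_differences.
- exact: order_dihedral_reflection.
- exact: dihedral_pattern_cosets.
- apply: subset_trans (pcore_sub _ _) _.
  by apply/subsetP=> u _; apply/cent1P/(centsP unit_prod_abelian); rewrite inE.
by rewrite odd_2'nat; apply: pcore_pgroup.
Qed.

End ProductOfFields.

Lemma big_seq_sub (R : Type) (idx : R) (op : Monoid.com_law idx)
    (T : choiceType) (s : seq T) (f : T -> R) :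
  uniq s -> \big[op/idx]_(x : seq_sub s) f (val x) = \big[op/idx]_(x <- s) f x.
Proof.
move=> Us; rewrite -[in RHS](val_seq_sub_enum Us) big_map.
by rewrite -big_enum enumT [@Finite.enum]unlock.
Qed.

Lemma psiE N :
  psi N = \prod_(p : seq_sub (primes N)) (#|component_field p| - 1).
Proof.
under eq_bigr do rewrite card_component_field.
rewrite (big_seq_sub _ (fun p => p ^ logn p N - 1)) ?primes_uniq //.
by rewrite /psi big_map.
Qed.

Theorem theorem7p4 (n : nat) (n_gt0 : (0 < n)%N)
    (hn : forall q : nat, q \in components (4 * n + 1) -> q = 1 %[mod 4]) :
  exists (J : {group DV (4 * n + 1)}) (F : seq {set DV (4 * n + 1)}),
    [/\ J \subset Dx0 (4 * n + 1),
        #|J| = 2,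
        difference_family (Dx0 (4 * n + 1)) F,
        resolvable (Dx0 (4 * n + 1)) J F &
        exists A : {group {perm DV (4 * n + 1)}},
          (forall a : {perm DV (4 * n + 1)},
             a \in A -> strong_multiplier (Dx0 (4 * n + 1)) F a) /\
          #|A| = greatest_odd_divisor (psi (4 * n + 1))].
Proof.
rewrite psiE.
apply: (@field_prod_resolvable_family _ (@component_field (4 * n + 1))) => p.
by rewrite card_component_field; apply/hn/map_f/valP.
Qed.
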